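(* Let $R$ be a nonzero associative unital ring, $n$ a positive integer, $G$ a group with identity element $e$, and let $\rho=\overline{n}\times\overline{n}$ where $\overline{n}=\{1,\ldots,n\}$, so that $M_n(\rho,R)=M_n(R)$. Under the bijection $\Phi:\mathcal{G}(\rho,G,R)\to\mathcal{A}(\rho,G)$, the strictly elementary $G$-gradings on $M_n(R)$ correspond precisely to the free and transitive partial actions of $G$ on $\overline{n}$.
   Context: Gradings. For $X,Y\subseteq\overline{n}\times\overline{n}$ put $XY=\{(i,k)\mid \exists j\in\overline{n}:\ (i,j)\in X,\ (j,k)\in Y\}$. A $G$-grading on $\rho$ is a family $(\rho_g)_{g\in G}$ of pairwise disjoint (possibly empty) subsets of $\rho$ with $\rho=\bigcup_{g\in G}\rho_g$ and $\rho_g\rho_h\subseteq\rho_{gh}$ for all $g,h\in G$. Let $e_{i,j}$ be the matrix with $1$ in position $(i,j)$ and zeros elsewhere, and $M_n(\rho,R)=\sum_{(i,j)\in\rho}Re_{i,j}$. A $G$-grading $(S_g)_{g\in G}$ on $M_n(\rho,R)$ is very good if there is a $G$-grading $(\rho_g)_{g\in G}$ on $\rho$ with $S_g=\sum_{(i,j)\in\rho_g}Re_{i,j}$ for all $g\in G$. $\mathcal{G}(\rho,G,R)$ is the set of all very good $G$-gradings $(S_g)_{g\in G}$ on $M_n(\rho,R)$ with $S_e=\bigoplus_{i=1}^nRe_{i,i}$. A very good $G$-grading on $M_n(\rho,R)$ is elementary if it is induced by an $n$-tuple $(g_1,\ldots,g_n)\in G^n$ in the sense that $\deg(e_{i,j})=g_ig_j^{-1}$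 (i.e. $e_{i,j}\in S_{g_ig_j^{-1}}$) whenever $(i,j)\in\rho$; it is strictly elementary if moreover $g_1,\ldots,g_n$ are pairwise distinct. Partial actions. A partial action of $G$ on a set $X$ is a family $\alpha=(X_g,\alpha_g)_{g\in G}$, where $X_g\subseteq X$ and $\alpha_g:X_{g^{-1}}\to X_g$ is a bijection for every $g\in G$, such that (P1) $X_e=X$ and $\alpha_e=\mathrm{id}_X$; (P2) if $g,h\in G$, $x\in X_{h^{-1}}$ and $\alpha_h(x)\in X_{g^{-1}}$, then $x\in X_{(gh)^{-1}}$ and $\alpha_{gh}(x)=\alpha_g(\alpha_h(x))$. It is free if, whenever $x\in X_{g^{-1}}\cap X_{h^{-1}}$ and $\alpha_g(x)=\alpha_h(x)$, one has $g=h$. Its orbit equivalence relation is: $i\sim_\alpha j$ if and only if $\alpha_g(j)=i$ for some $g\in G$ with $j\in X_{g^{-1}}$. It is transitive if $i\sim_\alpha j$ for all $i,j\in X$. $\mathcal{A}(\rho,G)$ is the set of all free partial actions of $G$ on $\overline{n}$ whose orbit equivalence relation is $\rho$. The bijection $\Phi$. For $\mathcal{S}=(S_g)_{g\in G}\in\mathcal{G}(\rho,G,R)$ and $g\in G$ put $\rho_g^{\mathcal{S}}=\{(i,j)\in\rho\mid e_{i,j}\in S_g\}$ and $X_g^{\mathcal{S}}=\{i\in\overline{n}\mid (i,j)\in\rho_g^{\mathcal{S}}\text{ for some }j\in\overline{n}\}$, and let $\alpha_g^{\mathcal{S}}:X_{g^{-1}}^{\mathcal{S}}\to X_g^{\mathcal{S}}$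 be given by $\alpha_g^{\mathcal{S}}(j)=i\Leftrightarrow(i,j)\in\rho_g^{\mathcal{S}}$; then $\Phi(\mathcal{S}):=(X_g^{\mathcal{S}},\alpha_g^{\mathcal{S}})_{g\in G}$. The map $\Phi$ is a bijection with inverse sending $(X_g,\alpha_g)_{g\in G}$ to the grading with components $\bigoplus_{j\in X_{g^{-1}}}Re_{\alpha_g(j),j}$. ''Correspond precisely'' means that the set of strictly elementary $G$-gradings on $M_n(R)$ is contained in $\mathcal{G}(\rho,G,R)$ and is mapped by $\Phi$ bijectively onto the set of free and transitive partial actions of $G$ on $\overline{n}$. *)

(* Defs.v *)
From HB Require Import structures.
From mathcomp Require Import all_boot all_order all_algebra.
From mathcomp Require Import mathcomp_extra boolp classical_sets functions.

Set Implicit Arguments.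
Unset Strict Implicit.
Unset Printing Implicit Defensive.

Import GRing.Theory.
Local Open Scope classical_set_scope.
Local Open Scope ring_scope.

Section SetGradings.
Variables (G : groupType) (n : nat).

(* [B \; A] composes from right to left, so that the product [XY] of the sets
   of pairs [X] and [Y] is [Y \; X]. *)
Definition set_grading (rho : set ('I_n * 'I_n))
    (rhog : G -> set ('I_n * 'I_n)) : Prop :=
  [/\ trivIset setT rhog,
      rho = \bigcup_g rhog g
    & forall g h, (rhog h \; rhog g)%relation `<=` rhog (g * h)%g].

End SetGradings.

(* [A] is the internal direct sum of the additive subgroups [S i]; the index
   type may be infinite, so sums range over finite sequences of indices. *)
Definition internal_direct_sum (I : eqType) (V : zmodType) (A : set V)
    (S : I -> set V) : Prop :=
  [/\ forall i, zmod_closed [in S i],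
      A = [set x | exists (r : seq I) (s : I -> V),
             (forall i, S i (s i)) /\ x = \sum_(i <- r) s i]
    & forall (r : seq I) (s : I -> V), uniq r -> (forall i, S i (s i)) ->
        \sum_(i <- r) s i = 0 -> forall i, i \in r -> s i = 0].

Section MatrixGradings.
Variables (R : nzRingType) (G : groupType) (n : nat).
Implicit Type rho : set ('I_n * 'I_n).

(* The sum of the [R e_{i,j}] over the pairs [(i, j)] in [P]; for [P = rho] it
   is M_n(rho, R), and for [P = setT] all of M_n(R). *)
Definition span_units (P : set ('I_n * 'I_n)) : set 'M[R]_n :=
  [set M | exists a : 'I_n * 'I_n -> R,
     M = \sum_(p in P) a p *: delta_mx p.1 p.2].

Definition grading (rho : set ('I_n * 'I_n)) (S : G -> set 'M[R]_n) : Prop :=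
  internal_direct_sum (span_units rho) S /\
  forall g h (A B : 'M[R]_n), S g A -> S h B -> S (g * h)%g (A *m B).

Definition very_good (rho : set ('I_n * 'I_n))
    (S : G -> set 'M[R]_n) : Prop :=
  grading rho S /\
  exists rhog : G -> set ('I_n * 'I_n),
    set_grading rho rhog /\ forall g, S g = span_units (rhog g).

Definition calG (rho : set ('I_n * 'I_n)) : set (G -> set 'M[R]_n) :=
  [set S | very_good rho S /\ S 1%g = span_units [set p | p.1 = p.2]].

Definition induced_by (rho : set ('I_n * 'I_n)) (t : n.-tuple G)
    (S : G -> set 'M[R]_n) : Prop :=
  forall i j, rho (i, j) -> S (tnth t i * (tnth t j)^-1)%g (delta_mx i j).

Definition elementary (rho : set ('I_n * 'I_n)) : set (G -> set 'M[R]_n) :=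
  [set S | very_good rho S /\ exists t : n.-tuple G, induced_by rho t S].

Definition strictly_elementary (rho : set ('I_n * 'I_n)) :
    set (G -> set 'M[R]_n) :=
  [set S | very_good rho S /\
     exists t : n.-tuple G, uniq t /\ induced_by rho t S].

End MatrixGradings.

Arguments calG R G {n} rho.
Arguments elementary R G {n} rho.
Arguments strictly_elementary R G {n} rho.

(* A family [(X_g, alpha_g)_g] of subsets of [X] and partial maps on [X];
   [act a g x = Some y] means [alpha_g x = y], and [act a g x = None] means
   that [x] lies outside the domain of [alpha_g]. *)
Record partial_family (G X : Type) := PartialFamily {
  dom : G -> set X;
  act : G -> X -> option X
}.

Section PartialActions.
Variables (G : groupType) (X : Type).
Implicit Type a : partial_family G X.

(* The first clause says that [alpha_g] is a bijection from [X_{g^-1}] onto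
   [X_g], the second that it is defined on [X_{g^-1}] only. *)
Definition partial_action a : Prop :=
  [/\ forall g, set_bij (dom a g^-1%g) (Some @` dom a g) (act a g),
      forall g x, ~ dom a g^-1%g x -> act a g x = None,
      dom a 1%g = setT /\ (forall x, act a 1%g x = Some x)
    & forall g h x y,
        dom a h^-1%g x -> act a h x = Some y -> dom a g^-1%g y ->
        dom a (g * h)^-1%g x /\ act a (g * h)%g x = act a g y].

Definition free_pa a : Prop :=
  forall g h x, dom a g^-1%g x -> dom a h^-1%g x ->
    act a g x = act a h x -> g = h.

Definition orbit_rel a : set (X * X) :=
  [set p | exists g, dom a g^-1%g p.2 /\ act a g p.2 = Some p.1].

Definition transitive_pa a : Prop := forall i j, orbit_rel a (i, j).

Definition free_transitive_actions : set (partial_family G X) :=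
  [set a | [/\ partial_action a, free_pa a & transitive_pa a]].

End PartialActions.

Arguments free_transitive_actions G X : clear implicits.

Definition calA (G : groupType) (n : nat) (rho : set ('I_n * 'I_n)) :
    set (partial_family G 'I_n) :=
  [set a | [/\ partial_action a, free_pa a & orbit_rel a = rho]].

Arguments calA G {n} rho.

Section Phi.
Variables (R : nzRingType) (G : groupType) (n : nat).
Variable rho : set ('I_n * 'I_n).

Definition degree_rel (S : G -> set 'M[R]_n) (g : G) : set ('I_n * 'I_n) :=
  [set p | rho p /\ S g (delta_mx p.1 p.2)].

(* For [S] in [calG rho], with [rho] an equivalence relation, at most one [i]
   satisfies [degree_rel S g (i, j)], so that [pick] returns that [i]. *)
Definition Phi (S : G -> set 'M[R]_n) : partial_family G 'I_n :=
  {| dom := fun g => [set i | exists j, degree_rel S g (i, j)];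
     act := fun g j => [pick i | (i, j) \in degree_rel S g] |}.

End Phi.

Arguments Phi R G {n} rho S.

(* Main.v *)
(** A very good grading is determined by the sets of pairs [rho_g] recording the
    degrees of the matrix units, and so is a partial action by the graphs
    [{(i, j) | alpha_g j = i}]. A grading of [rho] whose component of degree
    [1] is the diagonal is the same thing as the family of graphs of a free
    partial action with orbit relation [rho]: since [rho] is symmetric,
    [rho_{g^-1}] is the inverse relation of [rho_g], so that each [rho_g] is
    the graph of a partial injection.

    When [rho] relates all indices, every such grading is strictly elementary,
    by taking for [g_i] the degree of [e_{i,i0}] for a fixed [i0]; conversely
    [g_i g_j^-1 = 1] forces [i = j] when the [g_i] are distinct. So both
    bijections are the same one. *)

Require Import Defs.
From mathcomp Require Import all_boot all_order all_algebra.
From mathcomp Require Import mathcomp_extra boolp classical_sets functions.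

Local Open Scope classical_set_scope.

(** * Spans of matrix units, and very good gradings as families of sets of pairs *)

Section SpanUnits.
Set Implicit Arguments.
Unset Strict Implicit.
Import GRing.Theory.
Local Open Scope ring_scope.
Variables (R : nzRingType) (n : nat).
Implicit Types P Q rho : set ('I_n * 'I_n).

(** Vanishing of entries replaces linear combinations in every later argument about spans. *)
Lemma span_unitsP P (M : 'M[R]_n) :
  span_units P M <-> forall i j, ~ P (i, j) -> M i j = 0.
Proof.
split=> [[a ->] i j nP|M0].
  rewrite summxE big1 // => -[k l]; rewrite inE => Pkl.
  rewrite !mxE /=; case: andP => [[/eqP ik /eqP jl]|_]; last by rewrite mulr0.
  by rewrite ik jl in nP.
exists (fun p => M p.1 p.2).
rewrite [LHS]matrix_sum_delta pair_bigA /=.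
rewrite [LHS](bigID (mem P)) /= [X in _ + X]big1 ?addr0 // => -[i j].
by move/negP => nP; rewrite M0 ?scale0r // => Pij; apply: nP; rewrite inE.
Qed.

(** Since [1 != 0] in [R], a span remembers its set of pairs. *)
Lemma span_units_delta P (i j : 'I_n) :
  span_units P (delta_mx i j : 'M[R]_n) <-> P (i, j).
Proof.
split=> [/span_unitsP PM|Pij].
  apply: contrapT => /PM /eqP; rewrite mxE !eqxx /=.
  by apply/negP; exact: oner_neq0.
apply/span_unitsP => k l nP; rewrite mxE.
by case: andP => // -[/eqP ki /eqP lj]; rewrite ki lj in nP.
Qed.

Lemma span_units_inj : injective (@span_units R n).
Proof.
move=> P Q PQ; apply/seteqP; split=> -[i j] /span_units_delta; rewrite ?PQ.
  by move/span_units_delta.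
by rewrite -PQ => /span_units_delta.
Qed.

Lemma span_units_zmod_closed P : zmod_closed [in @span_units R n P].
Proof.
split=> [|A B]; first by rewrite inE; apply/span_unitsP => i j _; rewrite mxE.
rewrite !inE => /span_unitsP PA /span_unitsP PB; apply/span_unitsP => i j nP.
by rewrite !mxE PA // PB // subr0.
Qed.

Variable G : groupType.
Implicit Types (r : G -> set ('I_n * 'I_n)) (S : G -> set 'M[R]_n).

Lemma span_units_internal_direct_sum rho r :
  trivIset setT r -> rho = \bigcup_g r g ->
  internal_direct_sum (span_units rho) (fun g => @span_units R n (r g)).
Proof.
move=> triv ->; split=> [g||s f us rf f0 g gs].
- exact: span_units_zmod_closed.
- apply/seteqP; split=> M /=; last first.
    move=> [s [f [rf ->]]]; apply/span_unitsP => i j nP.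
    rewrite summxE big1 // => g _; have /span_unitsP := rf g; apply=> rij.
    by apply: nP; exists g.
  move=> /span_unitsP PM.
  (* [d p] is the degree of the pair [p], with default [1] off the union. Only finitely many degrees
     occur, even when [G] is infinite; [M] is cut into its pieces of these degrees. *)
  have /choice[d dP] p : exists g, (\bigcup_g r g) p -> r g p.
    by have [[g _ rg]|nP] := pselect ((\bigcup_g r g) p);
      [exists g|exists 1%g].
  exists (undup [seq d p | p <- enum {: 'I_n * 'I_n}]).
  exists (fun g => \matrix_(i, j) if (i, j) \in r g then M i j else 0).
  split=> [g|].
    apply/span_unitsP => i j nP; rewrite mxE; case: ifP => //.
    by rewrite inE => /nP.
  apply/matrixP => i j; rewrite summxE.
  have [rij|nrij] := pselect ((\bigcup_g r g) (i, j)); last first.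
    by rewrite PM // big1 // => g _; rewrite mxE PM //; case: ifP.
  have rd := dP _ rij.
  rewrite (bigD1_seq (d (i, j))) ?undup_uniq //=; last first.
    by rewrite mem_undup map_f // mem_enum.
  rewrite mxE mem_set // big1 ?addr0 // => g gd.
  rewrite mxE; case: ifP => //; rewrite inE => rg.
  by case/eqP: gd; apply: triv => //; exists (i, j).
(* Independence: by disjointness, at a pair of [r g] only the summand [f g] can be nonzero. *)
- apply/matrixP => i j; rewrite mxE.
  have [rij|nrij] := pselect (r g (i, j)); last first.
    by have /span_unitsP := rf g; apply.
  have /matrixP/(_ i j) := f0; rewrite summxE (bigD1_seq g) //= mxE big1 ?addr0 //.
  move=> h hg; have /span_unitsP := rf h; apply=> rh.
  by case/eqP: hg; apply: triv => //; exists (i, j).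
Qed.

Lemma set_grading_very_good rho r :
  set_grading rho r -> very_good rho (fun g => @span_units R n (r g)).
Proof.
move=> rG; split; last by exists r.
case: rG => triv rhoE mulr; split.
  exact: span_units_internal_direct_sum.
move=> g h A B /span_unitsP rA /span_unitsP rB; apply/span_unitsP => i k nP.
rewrite mxE big1 // => j _.
have [rij|nrij] := pselect (r g (i, j)); last by rewrite rA // mul0r.
rewrite (rB j k) ?mulr0 // => rjk.
by apply/nP/mulr; exists j.
Qed.

Lemma degree_rel_span_units rho r :
  set_grading rho r -> degree_rel rho (fun g => @span_units R n (r g)) = r.
Proof.
move=> [_ rhoE _]; apply/funext => g; apply/seteqP.
split=> -[i j] /=; first by move=> [_ /span_units_delta].
by move=> rij; split; [rewrite rhoE; exists g|exact/span_units_delta].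
Qed.

(** The matrix-free counterpart of [calG], through which [Phi] is factored. *)
Definition set_calG rho : set (G -> set ('I_n * 'I_n)) :=
  [set r | set_grading rho r /\ r 1%g = [set p | p.1 = p.2]].

Lemma calGP rho S :
  calG R G rho S <->
  exists2 r, set_calG rho r & S = (fun g => span_units (r g)).
Proof.
split=> [[[_ [r [rG SE]]] S1]|[r [rG r1] ->]].
  by exists r; [split=> //; apply: span_units_inj; rewrite -SE|apply/funext].
by split; [exact: set_grading_very_good|rewrite r1].
Qed.

End SpanUnits.

(** * Families of sets of pairs as graphs of partial actions *)

Section Graphs.
Set Implicit Arguments.
Unset Strict Implicit.
Local Open Scope group_scope.
Variables (G : groupType) (n : nat).
Implicit Types (rho : set ('I_n * 'I_n)) (r : G -> set ('I_n * 'I_n)).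
Implicit Type a : partial_family G 'I_n.

Definition graph a (g : G) : set ('I_n * 'I_n) :=
  [set p | act a g p.2 = Some p.1].

Definition family_of_graph r : partial_family G 'I_n :=
  {| dom := fun g => [set i | exists j, r g (i, j)];
     act := fun g j => [pick i | (i, j) \in r g] |}.

Section OfSetGrading.
Variables (rho : set ('I_n * 'I_n)) (r : G -> set ('I_n * 'I_n)).
Hypothesis rG : set_calG rho r.

Lemma set_calG_mul g h i j k :
  r g (i, j) -> r h (j, k) -> r (g * h) (i, k).
Proof. by have [[_ _ mulr] _] := rG => ? ?; apply: mulr; exists j. Qed.

Lemma set_calG_uniq g h p : r g p -> r h p -> g = h.
Proof. by have [[triv _ _] _] := rG => rg rh; apply: triv => //; exists p. Qed.

Lemma set_calG1 i j : r 1 (i, j) <-> i = j.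
Proof. by have [_ ->] := rG. Qed.

Hypothesis rho_sym : forall i j, rho (i, j) -> rho (j, i).

(** By symmetry [(j, i)] has some degree [h]. Then [(i, i)] has degrees [g * h] and [1], so
    disjointness forces [h = g^-1]. *)
Lemma set_calG_inv g i j : r g (i, j) -> r g^-1 (j, i).
Proof.
have [[_ rhoE _] _] := rG => rij.
have : rho (i, j) by rewrite rhoE; exists g.
move=> /rho_sym; rewrite rhoE => -[h _ rji].
have gh1 : g * h = 1.
  by apply: set_calG_uniq (set_calG_mul rij rji) _; exact/set_calG1.
by rewrite -(mulKg g h) gh1 mulg1 in rji.
Qed.

(** Composing [(i, k)] with the inverse pair [(k, j)] gives [(i, j)] of degree [1], hence a diagonal
    pair. *)
Lemma set_calG_injl g i j k : r g (i, k) -> r g (j, k) -> i = j.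
Proof.
move=> rik /set_calG_inv rkj; apply/set_calG1.
by rewrite -(mulgV g); exact: set_calG_mul rkj.
Qed.

Lemma set_calG_injr g i j k : r g (k, i) -> r g (k, j) -> i = j.
Proof. by move=> /set_calG_inv rik /set_calG_inv; exact: set_calG_injl. Qed.

Lemma graph_family_of_graph : graph (family_of_graph r) = r.
Proof.
apply/funext => g; apply/seteqP; split=> -[i j]; rewrite /graph /=.
  by case: pickP => // k; rewrite inE => + [<-].
move=> rij; case: pickP => [k|/(_ i)]; last by rewrite mem_set.
by rewrite inE => rkj; rewrite (set_calG_injl rij rkj).
Qed.

Lemma act_family_of_graph g i j :
  act (family_of_graph r) g j = Some i <-> r g (i, j).
Proof.
by rewrite -[act _ _ _ = _]/(graph (family_of_graph r) g (i, j))
  graph_family_of_graph.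
Qed.

Lemma domV_family_of_graph g j :
  dom (family_of_graph r) g^-1 j <-> exists i, r g (i, j).
Proof.
by split=> -[i /set_calG_inv]; rewrite ?invgK => rij; exists i.
Qed.

Lemma family_of_graph_calA : calA G rho (family_of_graph r).
Proof.
have actP := act_family_of_graph; have domP := domV_family_of_graph.
split; first split.
- move=> g; split.
  + move=> j /domP[i rij]; exists i; first by exists j.
    by apply/esym/actP.
  + move=> j k; rewrite !inE => /domP[i /[dup] rij /actP ->] _ /esym/actP rik.
    exact: set_calG_injr rij rik.
  + move=> _ [i [j rij] <-]; exists j; last exact/actP.
    by apply/domP; exists i.
- move=> g j nd; case E: (act _ g j) => [i|//].
  by case: nd; apply/domP; exists i; apply/actP.
- split=> [|i]; last by apply/actP/set_calG1.
  by apply/seteqP; split=> // i _; exists i; exact/set_calG1.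
- move=> g h x y _ /actP ryx /domP[z rzy].
  have rzx := set_calG_mul rzy ryx.
  split; first by apply/domP; exists z.
  by move/actP: rzy => ->; apply/actP.
- move=> g h j /domP[i rij] _; have /actP -> := rij.
  by move/esym/actP; exact: set_calG_uniq rij.
- have [[_ -> _] _] := rG; apply/seteqP; split=> -[i j] /=.
    by move=> [g [_ /actP rij]]; exists g.
  move=> [g _ rij]; exists g; split; last exact/actP.
  by apply/domP; exists i.
Qed.

End OfSetGrading.

Section OfPartialAction.
Variables (rho : set ('I_n * 'I_n)) (a : partial_family G 'I_n).
Hypothesis aA : calA G rho a.

Lemma act_domV g i j : act a g j = Some i -> dom a g^-1 j.
Proof.
have [[_ actN _ _] _ _] := aA => aji.
by apply: contrapT => /actN; rewrite aji.
Qed.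

Lemma act_dom g i j : act a g j = Some i -> dom a g i.
Proof.
have [[bij _ _ _] _ _] := aA => /[dup] /act_domV dj aji.
by have [/(_ j dj)[k dk]] := bij g; rewrite aji => -[<-].
Qed.

(** Freeness gives disjointness, the orbit relation gives the union, (P2) gives multiplicativity and
    (P1) the diagonal. *)
Lemma graph_set_calG : set_calG rho (graph a).
Proof.
have [[bij actN [_ act1] actM] free orb] := aA.
split; first split.
- move=> g h _ _ [[i j] [/= gij hij]].
  by apply: (free g h j); [exact: act_domV gij|exact: act_domV hij|
    rewrite gij].
- rewrite -orb; apply/seteqP; split=> -[i j] /=.
    by move=> [g [_ gij]]; exists g.
  by move=> [g _ gij]; exists g; split=> //; exact: act_domV gij.
- move=> g h [i k] /= [j gij hjk]; rewrite /graph /=.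
  have [] := actM g h k j (act_domV hjk) hjk (act_domV gij).
  by move=> _ ->.
- by apply/seteqP; split=> -[i j]; rewrite /graph /= act1; [case|move=> ->].
Qed.

Lemma family_of_graphK : family_of_graph (graph a) = a.
Proof.
have [[bij _ _ _] _ _] := aA.
have domE : dom (family_of_graph (graph a)) = dom a.
  apply/funext => g; apply/seteqP; split=> i; first by move=> [j /act_dom].
  (* Surjectivity of [alpha_g] onto [X_g] makes the graph determine [X_g]. *)
  move=> di; have [_ _ /(_ (Some i))[]] := bij g; first by exists i.
  by move=> j _ aji; exists j.
have actE : act (family_of_graph (graph a)) = act a.
  apply/funext => g; apply/funext => j /=.
  case: pickP => [i|noi]; first by rewrite inE.
  by case E: (act a g j) => [i|//]; have := noi i; rewrite mem_set.
by move: (family_of_graph _) domE actE => -[d t] /= -> ->; case: (a).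
Qed.

End OfPartialAction.
End Graphs.

(** * The bijection [Phi] and strictly elementary gradings *)

Section PhiBijection.
Set Implicit Arguments.
Unset Strict Implicit.
Variables (R : nzRingType) (G : groupType) (n : nat).
Implicit Type rho : set ('I_n * 'I_n).

Lemma Phi_span_units rho (r : G -> set ('I_n * 'I_n)) :
  set_calG rho r ->
  Phi R G rho (fun g => span_units (r g)) = family_of_graph r.
Proof.
(* [Phi] of a grading is by definition [family_of_graph] of its [degree_rel]. *)
by move=> [rG _]; rewrite -[in RHS](degree_rel_span_units R rG).
Qed.

Lemma Phi_bij rho : (forall i j, rho (i, j) -> rho (j, i)) ->
  set_bij (calG R G rho) (calA G rho) (Phi R G rho).
Proof.
move=> rho_sym; split.
- move=> _ /calGP[r rG ->]; rewrite Phi_span_units //.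
  exact: family_of_graph_calA rG rho_sym.
- move=> S T; rewrite !inE => /calGP[r rG ->] /calGP[s sG ->].
  rewrite !Phi_span_units // => rs.
  rewrite -(graph_family_of_graph rG rho_sym) rs.
  by rewrite (graph_family_of_graph sG rho_sym).
- move=> a aA; have gG := graph_set_calG aA.
  exists (fun g => span_units (graph a g)); first by apply/calGP; exists (graph a).
  by rewrite Phi_span_units // (family_of_graphK aA).
Qed.

Lemma strictly_elementary_sub_calG :
  strictly_elementary R G [set: 'I_n * 'I_n] `<=` calG R G setT.
Proof.
move=> S [Svg [t [ut tS]]]; split=> //.
have [_ [r [[triv _ _] SE]]] := Svg; rewrite SE; congr span_units.
have rt i j : r (tnth t i * (tnth t j)^-1)%g (i, j).
  by apply/(span_units_delta R); rewrite -SE; exact: tS.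
apply/seteqP; split=> -[i j] /= => [r1|<-]; last first.
  by have := rt i i; rewrite mulgV.
(* The pair [(i, j)] lies in the components of both degrees, so they agree, and distinctness of the
   entries of [t] then gives [i = j]. *)
have t1 : (tnth t i * (tnth t j)^-1 = 1)%g by apply: triv => //; exists (i, j).
by apply/(tuple_uniqP t ut)/divg1_eq.
Qed.

Lemma calG_sub_strictly_elementary : (0 < n)%N ->
  calG R G [set: 'I_n * 'I_n] `<=` strictly_elementary R G setT.
Proof.
move=> hn S SG; split; first by case: SG.
have /calGP[r rG ->] := SG; have [[_ rT _] _] := rG.
have sym (i j : 'I_n) : setT (i, j) -> [set: 'I_n * 'I_n] (j, i) by [].
pose i0 := Ordinal hn.
have /choice[d dP] i : exists g, r g (i, i0).
  by have : setT (i, i0) by []; rewrite rT => -[g _ rg]; exists g.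
(* Pass through the base index: [(i, i0)] has degree [d i] and [(i0, j)] has degree [(d j)^-1]. *)
have rd i j : r (d i * (d j)^-1)%g (i, j).
  exact: (set_calG_mul rG (dP i) (set_calG_inv rG sym (dP j))).
exists [tuple d i | i < n]; split.
  (* If [d i = d j], then [(i, j)] has degree [1] and is diagonal. *)
  rewrite map_inj_uniq ?enum_uniq // => i j dij.
  by apply/(set_calG1 rG); rewrite -(mulgV (d i)) {2}dij.
by move=> i j _; rewrite !tnth_mktuple; exact/span_units_delta.
Qed.

Lemma free_transitive_actionsE :
  free_transitive_actions G 'I_n = calA G [set: 'I_n * 'I_n].
Proof.
apply/seteqP; split=> a [aP aF aT]; split=> //.
  by apply/seteqP; split=> // -[i j] _; exact: aT.
by move=> i j; rewrite aT.
Qed.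

End PhiBijection.

Theorem corollary36 (R : nzRingType) (n : nat) (hn : (0 < n)%N)
    (G : groupType) :
  let rho := [set: 'I_n * 'I_n] in
  [/\ set_bij (calG R G rho) (calA G rho) (Phi R G rho),
      strictly_elementary R G rho `<=` calG R G rho
    & set_bij (strictly_elementary R G rho) (free_transitive_actions G 'I_n)
        (Phi R G rho)].
Proof.
move=> rho; have bij : set_bij (calG R G rho) (calA G rho) (Phi R G rho).
  exact: Phi_bij.
have sub := @strictly_elementary_sub_calG R G n.
split=> //; rewrite free_transitive_actionsE.
suff -> : strictly_elementary R G rho = calG R G rho by [].
by apply/seteqP; split=> //; exact: calG_sub_strictly_elementary.
Qed.
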